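(* Let $\{Y_j:j\ge0\}$ be a Markov chain with countable state space $\mathcal M$. Suppose there exist a function $V:\mathcal M\to[0,\infty)$, constants $b\ge0$ and $p_0>0$, and two disjoint subsets $M_0,M_1$ of $\mathcal M$ such that (i) $\mathbb E[V(Y_1)-V(Y_0)\mid Y_0=x]\le -1+b\,\mathbb I\{x\in M_1\}$ for all $x\in M_0^c$; (ii) $\mathbb P(Y_1\in M_0\mid Y_0=x)\ge p_0$ for all $x\in M_1$. Then for every $x\in M_0^c$, $$\mathbb E[\tau(M_0)\mid Y_0=x]\le V(x)+\frac{b}{p_0}.$$
   Context: $\mathbb I\{\cdot\}$ denotes the indicator, $M_0^c=\mathcal M\setminus M_0$. For $M\subseteq\mathcal M$, $\tau(M)=\inf\{n\ge1:Y_n\in M\}$ is the first entrance time to $M$. The Markov chain is time-homogeneous. *)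

(* Defs.v *)
From HB Require Import structures.
From mathcomp Require Import all_boot all_order all_algebra.
From mathcomp Require Import all_classical all_reals all_analysis.

Set Implicit Arguments.
Unset Strict Implicit.
Unset Printing Implicit Defensive.

Import Order.TTheory GRing.Theory Num.Theory.
Local Open Scope classical_set_scope.
Local Open Scope ring_scope.

(* P(A | B); meaningful only when P(B) <> 0. *)
Definition cond_prob (R : realType) (d : measure_display)
    (T : measurableType d) (P : probability T R) (A B : set T) : R :=
  fine (P (A `&` B)) / fine (P B).

Definition history (T S : Type) (Y : nat -> T -> S) (n : nat) (s : nat -> S) :
    set T :=
  [set w | forall k, (k <= n)%N -> Y k w = s k].

(* A time-homogeneous Markov chain Y with countable (discrete) state space S is
   given together with its laws P x, where P x is the law conditionally on
   Y 0 = x: thus P[ . | Y_0 = x] and E[ . | Y_0 = x] are P x and the expectation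
   under P x, for every state x, whatever the initial distribution.
   The one-step transition probability from x to y is P x [Y 1 = y]. *)
Record markov_chain (R : realType) (d d' : measure_display)
    (T : measurableType d) (S : measurableType d')
    (P : S -> probability T R) (Y : nat -> {mfun T >-> S}) : Prop := {
  markov_countable : countable [set: S];
  markov_discrete : forall A : set S, measurable A;
  markov_initial : forall x : S, P x [set w | Y 0%N w = x] = 1%E;
  markov_property : forall (x : S) (n : nat) (s : nat -> S) (y : S),
    P x (history Y n s) != 0%E ->
    cond_prob (P x) [set w | Y n.+1 w = y] (history Y n s) =
    fine (P (s n) [set w | Y 1%N w = y])
}.

(* The infimum is +oo if Y never enters M at a time n >= 1. *)
Definition entrance_time (R : realType) (T S : Type) (Y : nat -> T -> S)
    (M : set S) (w : T) : \bar R :=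
  ereal_inf [set (n%:R)%:E | n in [set n : nat | (1 <= n)%N /\ M (Y n w)]].

(* Main.v *)
Require Import Defs.
From HB Require Import structures.
From mathcomp Require Import all_boot all_order all_algebra.
From mathcomp Require Import all_classical all_reals all_analysis.
From mathcomp Require Import measurable_realfun lra.

Set Implicit Arguments.
Unset Strict Implicit.
Unset Printing Implicit Defensive.

Import Order.TTheory GRing.Theory Num.Theory.
Local Open Scope classical_set_scope.
Local Open Scope ring_scope.

(** The process pays one unit of a potential at every step before it enters
    [M0], so it cannot survive longer on average than its initial potential
    allows. The drift condition alone says this for [V], except on [M1], where
    it may lose up to [b]. But each visit to [M1] is followed by an entrance
    into [M0] with probability at least [p0], so the potential
    [h = V + b / p0], killed on [M0], already accounts for that: killing it on
    [M0] gains at least [(b / p0) * p0 = b] in expectation from a point of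
    [M1]. Hence [1 + E_z(h(Y_1); Y_1 not in M0) <= h z] for every [z] outside
    [M0] ([restricted_potential_le] and [expectation_next_le]).

    Any nonnegative [h] with that property bounds the mean entrance time
    ([expected_entrance_time_le]). Let [A_n] be the event that
    [Y_0, ..., Y_n] all avoid [M0]. By the Markov property
    [P(A_n) + E(h(Y_(n+1)); A_(n+1)) <= E(h(Y_n); A_n)]
    ([avoids_potential_step]); summing over [n] gives
    [sum_n P(A_n) <= h x], and the entrance time is at most
    [sum_n 1_(A_n)] almost surely.

    The Markov property is given for complete histories, whereas the argument
    needs it on [A_n] with [Y_n = z], a countable union of histories.
    [markov_avoids_then_follows] frees one coordinate of the history at a time,
    so that only unions over the countable state space occur. These unions are
    handled by two comparison principles: integrals may be compared on the
    fibers of a variable with values in the state space ([le_integral_fibers]),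
    and proportional laws have proportional integrals
    ([integral_proportional_law]). *)

(** * Random variables with countably many values *)

Lemma measurable_event (d d' : measure_display) (T : measurableType d)
    (S : measurableType d') (discS : forall A : set S, measurable A)
    (X : {mfun T >-> S}) (A : set S) :
  measurable [set w | A (X w)].
Proof. by rewrite -[X in measurable X]setTI; exact: (measurable_funP X). Qed.

Section countable_fibers.
Local Open Scope ereal_scope.
Context (R : realType) (d0 d d' : measure_display) (S : measurableType d0)
  (T : measurableType d) (T' : measurableType d')
  (countS : countable [set: S]) (discS : forall A : set S, measurable A)
  (mu : {measure set T -> \bar R}) (nu : {measure set T' -> \bar R}).

(** Both integrals are countable sums over the fibers. The two variables may
    live on different probability spaces; this is what allows a comparison of
    the law of the chain at time [n + 1] with a law at time 1. *)
Lemma le_integral_fibers (D : set T) (D' : set T')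
    (X : {mfun T >-> S}) (X' : {mfun T' >-> S})
    (f : T -> \bar R) (f' : T' -> \bar R) :
    measurable D -> measurable D' ->
    measurable_fun D f -> measurable_fun D' f' ->
    (forall w, D w -> 0 <= f w) -> (forall w, D' w -> 0 <= f' w) ->
    (forall y, \int[mu]_(w in D `&` [set w | X w = y]) f w <=
               \int[nu]_(w in D' `&` [set w | X' w = y]) f' w) ->
  \int[mu]_(w in D) f w <= \int[nu]_(w in D') f' w.
Proof.
have /countable_injP[e e_inj] := countS.
(* The injection e labels the fibers by natural numbers; unused labels give
   empty fibers. *)
have decomp (U : Type) (B : set U) (Z : U -> S) :
    B = \bigcup_i (B `&` [set w | e (Z w) = i]).
  by apply/seteqP; split=> [w Bw|w [i _ []]//]; exists (e (Z w)).
have triv (U : Type) (B : set U) (Z : U -> S) :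
    trivIset setT (fun i => B `&` [set w | e (Z w) = i]).
  by move=> i j _ _ [w [[_ <-] [_ <-]]].
move=> mD mD' mf mf' f0 f0' le_fib.
have meas (B : set S) : measurable (D `&` [set w | B (X w)]).
  by apply: measurableI => //; exact: measurable_event.
have meas' (B : set S) : measurable (D' `&` [set w | B (X' w)]).
  by apply: measurableI => //; exact: measurable_event.
rewrite (decomp _ D X) (decomp _ D' X') !ge0_integral_bigcup -?decomp//.
- apply: lee_nneseries => i _.
    by move=> _; apply: integral_ge0 => w [? _]; exact: f0.
  have [[y ey]|ni] := pselect (exists y, e y = i).
    have fibE U (B : set U) (Z : U -> S) :
        B `&` [set w | e (Z w) = i] = B `&` [set w | Z w = y].
      apply/seteqP; split=> w /= [Bw]; last by move=> ->.
      by rewrite -ey => /e_inj ->; rewrite ?inE.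
    by rewrite !fibE.
  have fib0 U (B : set U) (Z : U -> S) : B `&` [set w | e (Z w) = i] = set0.
    by apply/seteqP; split=> w //= [_ ew]; apply: ni; exists (Z w).
  by rewrite !fib0 !integral_set0.
- by move=> i; apply: (meas' [set y | e y = i]).
- by move=> i; apply: (meas [set y | e y = i]).
Qed.

End countable_fibers.

Section proportional_law.
Local Open Scope ereal_scope.
Context (R : realType) (d0 d d' : measure_display) (S : measurableType d0)
  (T : measurableType d) (T' : measurableType d')
  (countS : countable [set: S]) (discS : forall A : set S, measurable A)
  (mu : {measure set T -> \bar R}) (nu : {measure set T' -> \bar R}).

(** On the fiber over [y] the integrand is the constant [h y], so the
    hypothesis is the equality of the two integrals there. *)
Lemma integral_proportional_law (D : set T) (D' : set T')
    (X : {mfun T >-> S}) (X' : {mfun T' >-> S}) (c : R) (h : S -> \bar R) :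
    measurable D -> measurable D' -> (0 <= c)%R -> (forall y, 0 <= h y) ->
    (forall y, mu (D `&` [set w | X w = y]) =
               c%:E * nu (D' `&` [set w | X' w = y])) ->
  \int[mu]_(w in D) h (X w) = c%:E * \int[nu]_(w in D') h (X' w).
Proof.
move=> mD mD' c0 h0 prop.
have mh d1 (U : measurableType d1) (B : set U) (Z : {mfun U >-> S}) :
    measurable_fun B (h \o Z).
  apply: measurable_funTS; exact: measurableT_comp.
rewrite -ge0_integralZl_EFin//; last exact: mh.
have fib d1 (U : measurableType d1) (m : {measure set U -> \bar R}) (B : set U)
    (Z : {mfun U >-> S}) (k : S -> \bar R) y : measurable B ->
    \int[m]_(w in B `&` [set w | Z w = y]) k (Z w) =
    k y * m (B `&` [set w | Z w = y]).
  move=> mB; rewrite -integral_cst; last first.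
    by apply: measurableI => //; exact: (measurable_event discS Z [set y]).
  by apply: eq_integral => w /[!inE] -[_ /= ->].
have mc : measurable_fun D' (fun w => c%:E * h (X' w)).
  by apply: measurable_funeM; exact: mh.
have ch0 y : 0 <= c%:E * h y by rewrite mule_ge0.
have fibE y : \int[mu]_(w in D `&` [set w | X w = y]) h (X w) =
    \int[nu]_(w in D' `&` [set w | X' w = y]) (c%:E * h (X' w)).
  rewrite fib// (fib _ _ _ _ _ (fun y => c%:E * h y))// prop.
  by rewrite muleCA muleA.
apply/eqP; rewrite eq_le; apply/andP; split.
- apply: (le_integral_fibers countS discS (X := X) (X' := X')) => //.
  + exact: mh.
  + by move=> y; rewrite fibE.
- apply: (le_integral_fibers countS discS (X := X') (X' := X)) => //.
  + exact: mh.
  + by move=> y; rewrite fibE.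
Qed.

Lemma measure_proportional_law (D : set T) (D' : set T')
    (X : {mfun T >-> S}) (X' : {mfun T' >-> S}) (c : R) :
    measurable D -> measurable D' -> (0 <= c)%R ->
    (forall y, mu (D `&` [set w | X w = y]) =
               c%:E * nu (D' `&` [set w | X' w = y])) ->
  mu D = c%:E * nu D'.
Proof.
move=> mD mD' c0 prop.
have /= := integral_proportional_law (h := cst 1) mD mD' c0 (fun=> lee01) prop.
by rewrite !integral_cst// !mul1e.
Qed.

End proportional_law.

(** * The Markov property up to an unspecified past *)

Definition avoids (T S : Type) (Y : nat -> T -> S) (M : set S) (n : nat) :
    set T :=
  [set w | forall k, (k <= n)%N -> ~ M (Y k w)].

(** The interpolation, in [j], between a complete history ([j = 0]) and the
    event on which only the state at time [n] is prescribed and the earlier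
    ones avoid [M] ([j = n]). *)
Definition avoids_then_follows (T S : Type) (Y : nat -> T -> S) (M : set S)
    (n : nat) (s : nat -> S) (j : nat) : set T :=
  [set w | forall k, (k <= n)%N ->
    if (k < j)%N then ~ M (Y k w) else Y k w = s k].

Section markov_property.
Local Open Scope ereal_scope.
Context (R : realType) (d d' : measure_display) (T : measurableType d)
  (S : measurableType d') (P : S -> probability T R)
  (Y : nat -> {mfun T >-> S}) (hY : markov_chain P Y) (M : set S).

Let discS := markov_discrete hY.
Let countS := markov_countable hY.

Lemma measurable_avoids n : measurable (avoids Y M n).
Proof.
rewrite (_ : avoids Y M n =
    \bigcap_(k in [set k | (k <= n)%N]) [set w | (~` M) (Y k w)]).
  by apply: bigcap_measurable => [|k _];
    [exists 0%N|exact: (measurable_event discS)].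
by apply/seteqP; split=> w Aw k /Aw.
Qed.

Lemma measurable_avoids_then_follows n s j :
  measurable (avoids_then_follows Y M n s j).
Proof.
rewrite (_ : avoids_then_follows Y M n s j = \bigcap_(k in [set k | (k <= n)%N])
    [set w | (if (k < j)%N then ~` M else [set s k]) (Y k w)]).
  by apply: bigcap_measurable => [|k _];
    [exists 0%N|exact: (measurable_event discS)].
by apply/seteqP; split=> w Aw k /Aw; case: ifP.
Qed.

(** Induction on [j]: fixing the value [v] of [Y j] turns the event for [j + 1]
    into the event for [j] and the history [s] changed to [v] at [j], or into
    the empty event if [v] is in [M]. The transition probability depends only
    on [s n], which is unchanged since [j < n]; so the identity can be summed
    over [v]. *)
Lemma markov_avoids_then_follows x n s j y : (j <= n)%N ->
  P x (avoids_then_follows Y M n s j `&` [set w | Y n.+1 w = y]) =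
  (fine (P (s n) [set w | Y 1%N w = y]))%:E *
  P x (avoids_then_follows Y M n s j).
Proof.
elim: j s => [|j IHj] s.
  rewrite (_ : avoids_then_follows Y M n s 0 = history Y n s)//.
  have mH : measurable (history Y n s).
    by rewrite -(_ : avoids_then_follows Y M n s 0 = history Y n s);
      [exact: measurable_avoids_then_follows|].
  have mE : measurable [set w | Y n.+1 w = y].
    exact: (measurable_event discS _ [set y]).
  have mHE := measurableI _ _ mH mE.
  have [H0 _|H0 _] := eqVneq (P x (history Y n s)) 0.
    rewrite H0 mule0; apply/eqP; rewrite eq_le measure_ge0 andbT -H0.
    exact: measureIl.
  have := markov_property hY y H0; rewrite /cond_prob => <-.
  have fH0 : fine (P x (history Y n s)) != 0%R.
    by rewrite fine_eq0// fin_num_measure.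
  rewrite -[in X in _ = _ * X](fineK (fin_num_measure (P x) _ mH)) -EFinM.
  by rewrite divfK// fineK ?fin_num_measure// setIC.
move=> jn.
have fibE v : avoids_then_follows Y M n s j.+1 `&` [set w | Y j w = v] =
    if v \in M then set0
    else avoids_then_follows Y M n (fun k => if k == j then v else s k) j.
  apply/seteqP; split=> w.
    move=> [/= Aw Yv]; case: ifPn => [/set_mem Mv|Mv k kn].
      by have := Aw j (ltnW jn); rewrite ltnSn Yv.
    by have := Aw k kn; rewrite ltnS; case: ltngtP => // ->.
  case: ifPn => // Mv Aw; have Yv : Y j w = v.
    by have := Aw j (ltnW jn); rewrite ltnn eqxx.
  split=> // k kn; have := Aw k kn; rewrite ltnS.
  case: ltngtP => // -> _; rewrite Yv => vM.
  by move/negP: Mv; apply; rewrite inE.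
have mE : measurable [set w | Y n.+1 w = y].
  exact: (measurable_event discS _ [set y]).
apply: (measure_proportional_law countS discS (X := Y j) (X' := Y j)).
- by apply: measurableI => //; exact: measurable_avoids_then_follows.
- exact: measurable_avoids_then_follows.
- by rewrite fine_ge0.
- move=> v; rewrite setIAC fibE; case: ifPn => [_|Mv].
    by rewrite set0I !measure0 mule0.
  have := IHj (fun k => if k == j then v else s k) (ltnW jn).
  by rewrite gtn_eqF.
Qed.

Lemma markov_avoids x n z (h : S -> \bar R) : ~ M z -> (forall y, 0 <= h y) ->
  \int[P x]_(w in avoids Y M n `&` [set w | Y n w = z]) h (Y n.+1 w) =
  P x (avoids Y M n `&` [set w | Y n w = z]) * \int[P z]_w h (Y 1%N w).
Proof.
move=> Mz h0.
have -> : avoids Y M n `&` [set w | Y n w = z] =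
    avoids_then_follows Y M n (cst z) n.
  apply/seteqP; split=> w.
    move=> [Aw Yz] k kn; case: ifPn => [_|]; first exact: Aw.
    by rewrite -leqNgt => nk; have -> : k = n by apply/eqP; rewrite eqn_leq kn.
  move=> Aw; have Yz : Y n w = z by have := Aw n (leqnn n); rewrite ltnn.
  split=> // k; rewrite leq_eqVlt => /predU1P[->|kn]; first by rewrite Yz.
  by have := Aw k (ltnW kn); rewrite kn.
have mA := measurable_avoids_then_follows n (cst z) n.
rewrite -[X in X * _](fineK (fin_num_measure (P x) _ mA)).
apply: (integral_proportional_law countS discS) => //.
- by rewrite fine_ge0.
- move=> y; rewrite setTI.
  apply: etrans (markov_avoids_then_follows _ _ _ (leqnn n)) _; rewrite muleC.
  have mE : measurable [set w | Y 1%N w = y].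
    exact: (measurable_event discS _ [set y]).
  by rewrite !fineK ?fin_num_measure.
Qed.

Lemma integral_initial x (h : S -> \bar R) : (forall y, 0 <= h y) ->
  \int[P x]_w h (Y 0%N w) = h x.
Proof.
move=> h0.
have mE : measurable [set w | Y 0%N w = x].
  exact: (measurable_event discS _ [set x]).
have mh : measurable_fun setT (h \o Y 0%N) by exact: measurableT_comp.
rewrite (@ge0_negligible_integral _ _ _ _ _ (~` [set w | Y 0%N w = x]))//=.
- rewrite setTD setCK.
  rewrite (eq_integral (cst (h x))) ?integral_cst//; last first.
    by move=> w /[!inE]/= ->.
  by rewrite -[RHS]mule1; congr (_ * _); exact: (markov_initial hY).
- exact: measurableC.
- apply: etrans (probability_setC (P x) mE) _.
  by rewrite (markov_initial hY) subee.
Qed.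

End markov_property.

(** * The first entrance time *)

Section first_entrance.
Local Open Scope ereal_scope.
Context (R : realType).

(** Without measurability: the integral of a nonnegative function is a supremum
    over the simple functions below it. It is applied to the entrance time. *)
Lemma ge0_le_integralT d (T : measurableType d) (mu : {measure set T -> \bar R})
    (f1 f2 : T -> \bar R) :
    (forall w, 0 <= f1 w) -> (forall w, f1 w <= f2 w) ->
  \int[mu]_w f1 w <= \int[mu]_w f2 w.
Proof.
move=> f10 f12; have f20 w : 0 <= f2 w by exact: le_trans (f12 w).
rewrite !ge0_integralTE//; apply: le_ereal_sup => _ [h hf1 <-].
exists h => // w.
exact: le_trans (hf1 w) (f12 w).
Qed.

(** The entrance time counts the [n >= 0] for which no entrance occurs at the
    times [1, ..., n]. Time 0 is left out so that this holds for every [w] and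
    not only almost surely. *)
Lemma entrance_time_le_series (T S : Type) (Y : nat -> T -> S) (M : set S) w :
  entrance_time R Y M w <=
  \sum_(n <oo) (\1_[set w | forall k, (0 < k <= n)%N -> ~ M (Y k w)] w)%:E.
Proof.
set C := fun n => [set w | forall k, (0 < k <= n)%N -> ~ M (Y k w)].
have C0 n : 0 <= (\1_(C n) w)%:E :> \bar R by rewrite lee_fin.
have le_series m : (forall n, (n < m)%N -> C n w) ->
    (m%:R)%:E <= \sum_(n <oo) (\1_(C n) w)%:E :> \bar R.
  move=> Cm; apply: le_trans (nneseries_lim_ge m _) => //.
  rewrite sumEFin lee_fin big_nat (eq_bigr (fun=> 1%R)) -?big_nat.
    by rewrite sumr_const_nat subn0.
  by move=> n /= nm; rewrite indicE mem_set//; exact: Cm.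
have [[m [m0 Mm]]|noentry] := pselect (exists m, (1 <= m)%N /\ M (Y m w)).
  have ex : exists m, (1 <= m)%N && (Y m w \in M) by exists m; rewrite m0 inE.
  case: (ex_minnP ex) => q /andP[q0 /set_mem Mq] qmin.
  apply: (@le_trans _ _ (q%:R)%:E).
    by apply: ereal_inf_lbound; exists q.
  apply: le_series => n nq k /andP[k0 kn] Mk.
  have := qmin k; rewrite k0 mem_set// => /(_ isT).
  by rewrite leqNgt (leq_ltn_trans kn nq).
suff -> : \sum_(n <oo) (\1_(C n) w)%:E = +oo :> \bar R by rewrite leey.
apply/eqyP => r r0; apply: (@le_trans _ _ ((Num.bound r)%:R)%:E).
  by rewrite lee_fin ltW// archi_boundP// ltW.
apply: le_series => n _ k /andP[k0 _] Mk; apply: noentry.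
by exists k.
Qed.

End first_entrance.

(** * Potentials bounding the mean entrance time *)

Section supersolution.
Local Open Scope ereal_scope.
Context (R : realType) (d d' : measure_display) (T : measurableType d)
  (S : measurableType d') (P : S -> probability T R)
  (Y : nat -> {mfun T >-> S}) (hY : markov_chain P Y) (M : set S).

Let discS := markov_discrete hY.
Let countS := markov_countable hY.

Section potential.
Context (h : S -> \bar R) (h0 : forall y, 0 <= h y)
  (h_step : forall z, ~ M z ->
    1 + \int[P z]_w (h \_ (~` M)) (Y 1%N w) <= h z).

Let meas_comp (f : S -> \bar R) n (D : set T) : measurable_fun D (f \o Y n).
Proof. by apply: measurable_funTS; exact: measurableT_comp. Qed.

(** On the fiber [Y n = z] of the event that [M] is avoided up to time [n], the
    Markov property turns the left-hand side into the probability of the fiber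
    times [1 + E_z(h(Y_1); Y_1 not in M)], and [h_step] applies. *)
Lemma avoids_potential_step x n :
  P x (avoids Y M n) + \int[P x]_(w in avoids Y M n.+1) h (Y n.+1 w) <=
  \int[P x]_(w in avoids Y M n) h (Y n w).
Proof.
have mA m : measurable (avoids Y M m) by exact: (measurable_avoids hY).
set h' := h \_ (~` M).
have h'0 y : 0 <= h' y by apply: erestrict_ge0.
have mh' D : measurable_fun D (fun w => h' (Y n.+1 w)) by exact: meas_comp.
apply: (@le_trans _ _ (\int[P x]_(w in avoids Y M n) (1 + h' (Y n.+1 w)))).
  rewrite ge0_integralD// integral_cst// mul1e leeD2l//.
  have -> : \int[P x]_(w in avoids Y M n.+1) h (Y n.+1 w) =
            \int[P x]_(w in avoids Y M n.+1) h' (Y n.+1 w).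
    apply: eq_integral => w /[!inE] Aw; rewrite /h' patchT// inE.
    exact: Aw n.+1 (leqnn _).
  apply: ge0_subset_integral => // w Aw k kn.
  by apply: Aw; exact: leqW.
apply: (le_integral_fibers countS discS (X := Y n) (X' := Y n)) => //.
- exact: emeasurable_funD.
- exact: meas_comp.
- by move=> w _; exact: adde_ge0.
move=> z; have [Mz|Mz] := pselect (M z).
  rewrite (_ : _ `&` _ = set0) ?integral_set0//.
  by apply/seteqP; split=> w // [Aw /= Yz]; apply: (Aw n); rewrite ?Yz.
set F := _ `&` _.
have mF : measurable F.
  by apply: measurableI => //; exact: (measurable_event discS _ [set z]).
rewrite ge0_integralD// integral_cst// mul1e.
rewrite [X in _ + X](markov_avoids hY)//.
rewrite (eq_integral (cst (h z))) ?integral_cst//; last first.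
  by move=> w /[!inE] -[_ /= ->].
rewrite -[X in X + _]mule1 -ge0_muleDr// ?integral_ge0//.
by rewrite [leRHS]muleC lee_wpmul2l// h_step.
Qed.

Lemma sum_avoids_le x n : ~ M x ->
  \sum_(0 <= i < n) P x (avoids Y M i) +
    \int[P x]_(w in avoids Y M n) h (Y n w) <= h x.
Proof.
move=> Mx; elim: n => [|n IHn].
  rewrite big_nil add0e -[leRHS](integral_initial hY x h0).
  apply: ge0_subset_integral => //; first exact: (measurable_avoids hY).
  exact: meas_comp.
apply: le_trans IHn; rewrite big_nat_recr//= -addeA leeD2l//.
exact: avoids_potential_step.
Qed.

(** The bound is [sum_avoids_le] in the limit. The series of
    [entrance_time_le_series] ignores time 0, which changes no probability
    since the chain starts at [x], outside [M]. *)
Lemma expected_entrance_time_le x : ~ M x ->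
  \int[P x]_w entrance_time R Y M w <= h x.
Proof.
move=> Mx; pose C n := [set w | forall k, (0 < k <= n)%N -> ~ M (Y k w)].
have AC n : avoids Y M n = C n `&` [set w | (~` M) (Y 0%N w)].
  apply/seteqP; split=> w.
    by move=> Aw; split=> [k /andP[_]|]; [exact: Aw|exact: (Aw 0%N)].
  by move=> [Cw M0w] [|k] kn //; exact: Cw.
have mC n : measurable (C n).
  rewrite (_ : C n = \bigcap_(k in [set k | (k <= n)%N])
      [set w | (if k == 0%N then setT else ~` M) (Y k w)]).
    by apply: bigcap_measurable => [|k _];
      [exists 0%N|exact: (measurable_event discS)].
  apply/seteqP; split=> w Cw [|k] kn //=; exact: (Cw k.+1).
have PC n : P x (C n) = P x (avoids Y M n).
  have mE := measurable_event discS (Y 0%N) M.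
  have -> : avoids Y M n = C n `\` [set w | M (Y 0%N w)] by rewrite AC.
  apply: etrans (measureDI (P x) (mC n) mE) _.
  suff CM0 : P x (C n `&` [set w | M (Y 0%N w)]) = 0.
    by rewrite [X in _ + X]CM0 adde0.
  apply/eqP; rewrite eq_le measure_ge0 andbT.
  have m0 : measurable [set w | Y 0%N w = x].
    exact: (measurable_event discS _ [set x]).
  apply: (@le_trans _ _ (P x (~` [set w | Y 0%N w = x]))).
    apply: le_measure; rewrite ?inE; [exact: measurableI|exact: measurableC|].
    by move=> w [_ /= Mw] Yx; apply: Mx; rewrite -Yx.
  by rewrite probability_setC// (markov_initial hY) subee.
apply: (@le_trans _ _ (\int[P x]_w (\sum_(n <oo) (\1_(C n) w)%:E))).
  apply: ge0_le_integralT => w; last exact: entrance_time_le_series.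
  by apply: le_ereal_inf_tmp => _ [n _ <-]; rewrite lee_fin.
rewrite integral_nneseries//; last first.
  by move=> n; apply/measurable_EFinP; exact: measurable_indic.
apply: lime_le.
  apply: is_cvg_nneseries => n _ _.
  by apply: integral_ge0 => w _; rewrite lee_fin.
apply: nearW => n; apply: le_trans (sum_avoids_le n Mx).
rewrite (eq_bigr (fun i => P x (avoids Y M i))) => [|i _].
  by apply: leeDl; exact: integral_ge0.
by rewrite integral_indic// setIT; exact: PC.
Qed.

End potential.

(** A bound on the expectation of the difference gives one on [V (Y 1)] even
    though [V (Y 1)] is not assumed integrable: the negative part of
    [V (Y 1) - V (Y 0)] is at most [V (Y 0)], hence has a finite integral,
    which can be cancelled. *)
Lemma expectation_next_le (V : S -> R) (c : R) z : (forall y, 0 <= V y)%R ->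
    'E_(P z)[fun w => (V (Y 1%N w) - V (Y 0%N w))%R] <= c%:E ->
  \int[P z]_w (V (Y 1%N w))%:E <= (V z + c)%:E.
Proof.
move=> V0; rewrite unlock integralE.
set f := fun w => (V (Y 1%N w) - V (Y 0%N w))%:E.
have mV n : measurable_fun setT (fun w => (V (Y n w))%:E).
  have mVE : measurable_fun setT (EFin \o V) by [].
  exact: (measurableT_comp mVE).
have mf : measurable_fun setT f.
  by under [f]eq_fun do rewrite /f EFinB; exact: emeasurable_funB.
have initV : \int[P z]_w (V (Y 0%N w))%:E = (V z)%:E.
  by apply: (integral_initial hY z (h := EFin \o V)) => y; rewrite lee_fin.
have mfp : measurable_fun setT f^\+ by exact: measurable_funepos.
have mfn : measurable_fun setT f^\- by exact: measurable_funeneg.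
(* Moving the negative terms across keeps every integrand nonnegative, so that
   integrals add up without integrability. *)
have split_f : \int[P z]_w (V (Y 1%N w))%:E + \int[P z]_w f^\- w =
    \int[P z]_w f^\+ w + (V z)%:E.
  rewrite -initV.
  rewrite -!ge0_integralD//; try (by move=> w _; rewrite lee_fin).
  apply: eq_integral => w _; rewrite funeposE funenegE /f.
  rewrite -EFinN -!EFin_max -!EFinD; congr EFin.
  move: (V (Y 1 w)) (V (Y 0 w)) => v u.
  by case: (leP (v - u)%R 0%R); case: (leP (- (v - u))%R 0%R); lra.
have neg_le : \int[P z]_w f^\- w <= (V z)%:E.
  rewrite -initV.
  apply: ge0_le_integralT => // w; rewrite funenegE /f.
  rewrite -EFinN -EFin_max lee_fin ge_max V0 andbT opprB lerBlDr lerDl.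
  exact: V0.
have neg_fin : \int[P z]_w f^\- w \is a fin_num.
  rewrite ge0_fin_numE ?integral_ge0//.
  exact: le_lt_trans neg_le (ltry _).
rewrite leeBlDr// => pos_le.
rewrite -(leeD2rE _ _ neg_fin) split_f.
apply: (le_trans (leeD2r _ pos_le)).
by rewrite addeAC -EFinD (addrC c).
Qed.

End supersolution.

(** * The drift criterion *)

(** Where [X] is in [M] the left integrand is [c], and elsewhere it is
    [V X + c]: killing [V + c] on [M] saves at least [c] there. *)
Lemma restricted_potential_le (R : realType) (d d' : measure_display)
    (T : measurableType d) (S : measurableType d')
    (discS : forall A : set S, measurable A) (Q : probability T R)
    (X : {mfun T >-> S}) (M : set S) (V : S -> R) (c : R) :
    (forall y, 0 <= V y) -> 0 <= c ->
  (\int[Q]_w ((fun y => (V y + c)%:E) \_ (~` M)) (X w) +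
     c%:E * Q [set w | M (X w)] <=
   \int[Q]_w (V (X w))%:E + c%:E)%E.
Proof.
move=> V0 c0; set h := fun y => (V y + c)%:E.
have h0 y : (0 <= h y)%E by rewrite lee_fin addr_ge0.
have mE : measurable [set w | M (X w)] by exact: measurable_event.
have meas (f : S -> \bar R) : measurable_fun setT (fun w => f (X w)).
  have mf : measurable_fun setT f by move=> ? ? ?; exact: discS.
  exact: measurableT_comp mf _.
have h'0 y : (0 <= (h \_ (~` M)) y)%E by apply: erestrict_ge0.
have mind : measurable_fun [set: T] (fun w => (c * \1_[set w | M (X w)] w)%:E).
  by apply/measurable_EFinP; exact: measurable_funM.
have ind0 w : (0 <= (c * \1_[set w | M (X w)] w)%:E)%E.
  by rewrite lee_fin mulr_ge0.
have -> : (c%:E * Q [set w | M (X w)] =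
    \int[Q]_w (c * \1_[set w | M (X w)] w)%:E)%E.
  under eq_integral do rewrite EFinM.
  by rewrite ge0_integralZl_EFin// ?integral_indic// ?setIT//;
    apply/measurable_EFinP.
have <- : (\int[Q]_w cst c%:E w = c%:E)%E.
  rewrite integral_cst// -[RHS]mule1; congr (_ * _)%E.
  exact: probability_setT.
rewrite -!ge0_integralD//.
- apply: ge0_le_integralT => w; first by rewrite adde_ge0.
  rewrite /h patchE indicE; have [Mw|Mw] := pselect (M (X w)).
    rewrite (memNset (A := ~` M)) ?(mem_set (A := [set w | M (X w)]))//.
    by rewrite add0e mulr1 -EFinD lee_fin lerDr.
  by rewrite mem_set// memNset// mulr0 adde0.
- by move=> w _; rewrite lee_fin.
- exact: (meas (EFin \o V)).
Qed.

Theorem theorem3p1 (R : realType) (d d' : measure_display)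
    (T : measurableType d) (S : measurableType d')
    (P : S -> probability T R) (Y : nat -> {mfun T >-> S})
    (hY : markov_chain P Y)
    (V : S -> R) (hV : forall x, 0 <= V x)
    (b p0 : R) (hb : 0 <= b) (hp0 : 0 < p0)
    (M0 M1 : set S) (hM : M0 `&` M1 = set0)
    (drift : forall x, (~` M0) x ->
      ('E_(P x)[fun w => (V (Y 1%N w) - V (Y 0%N w))%R]
        <= (- 1 + b * \1_M1 x)%:E)%E)
    (hit : forall x, M1 x -> (p0%:E <= P x [set w | M0 (Y 1%N w)])%E)
    (x : S) (hx : (~` M0) x) :
  (\int[P x]_w entrance_time R Y M0 w <= (V x + b / p0)%:E)%E.
Proof.
have c0 : 0 <= b / p0 by rewrite divr_ge0// ltW.
pose h y := (V y + b / p0)%:E.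
have h0 y : (0 <= h y)%E by rewrite lee_fin addr_ge0.
apply: (expected_entrance_time_le hY h0 _ hx) => z Mz.
have I_hit :=
  restricted_potential_le (markov_discrete hY) (P z) (Y 1%N) M0 hV c0.
set I := (\int[P z]_w _)%E in I_hit *.
have V_next := expectation_next_le hY hV (drift _ Mz).
have {I_hit V_next} I_le : (I + (b / p0)%:E * P z [set w | M0 (Y 1%N w)] <=
    (V z - 1 + b * \1_M1 z + b / p0)%:E)%E.
  apply: (le_trans I_hit); rewrite [leRHS]EFinD leeD2r//.
  by rewrite -addrA.
(* The choice b / p0 makes the saving on M0 cover the loss b on M1. *)
have pay : ((b * \1_M1 z)%:E <= (b / p0)%:E * P z [set w | M0 (Y 1%N w)])%E.
  rewrite indicE; have [M1z|M1z] := pselect (M1 z).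
    rewrite mem_set// mulr1 -[in leLHS](divfK (lt0r_neq0 hp0) b) EFinM.
    by apply: lee_wpmul2l; [rewrite lee_fin|exact: hit].
  by rewrite memNset// mulr0 mule_ge0.
have : (I + (b * \1_M1 z)%:E <= (V z - 1 + b * \1_M1 z + b / p0)%:E)%E.
  by apply: le_trans I_le; rewrite leeD2l.
rewrite -leeBrDr// -EFinB => I_le'.
rewrite addeC -leeBrDr//; apply: (le_trans I_le').
by rewrite /h -EFinB lee_fin; lra.
Qed.
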